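(* Let $d\in\{2,3\}$ and let $M_1,M_2$ be two $d$-dimensional gray-scale images of the same shape with $n$ pixels (voxels) each, with integer intensities of $M_1$ in $\{0,\dots,m_1\}$ and of $M_2$ in $\{0,\dots,m_2\}$. Let $\mathbf{h}=(h_{M_1},h_{M_2}):Q\to[0,m_1]\times[0,m_2]$ be given by the pixel intensity filtering functions on the common cubical complex $Q$ of the images, and let the vector $\mathit{preCompChanges}$ of precomputed Euler characteristic changes be given. Then the procedure $P$ described in the context is correct. At the end of its main loop each entry $S_{\mathbf{h}}[s][t]$ equals $\chi(Q_{s,t})-\chi(Q_{s-1,t})$ (with $Q_{-1,t}=\emptyset$). After the cumulative sum on columns $S_{\mathbf{h}}[s][t]=\chi(Q_{s,t})$ for all $0\le s\le m_1$, $0\le t\le m_2$, so $P$ returns the Euler characteristic surface of the bi-filtration of sublevel sets of $\mathbf{h}$. Ignoring the time required to precompute $\mathit{preCompChanges}$, the worst-case running time of $P$ is $O(n m_2+m_1 m_2)$.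
   Context: A $d$-dimensional gray-scale image $M$ assigns an integer intensity $v_p$ to each pixel (voxel) $p$ of a $d$-dimensional rectangular grid. Its cubical complex $Q$ consists of the top-dimensional cubes $C_p$ (for $d=2$, $C_{i,j}=[i,i+1]\times[j,j+1]$ for pixel $(i,j)$, and analogously the unit cube $C_{i,j,k}$ for voxel $(i,j,k)$ when $d=3$) together with all their faces. Images of the same shape have the same $Q$. The pixel intensity filtering function $h_M:Q\to\mathbb{R}$ is $h_M(C_p)=v_p$ on top-dimensional cubes and $h_M(C)=\min_{C\subseteq C_p}h_M(C_p)$ for every element $C$ of $Q$. The Euler characteristic of a finite complex $X$ is $\chi(X)=\sum_i(-1)^i n_i$, with $n_i$ the number of $i$-dimensional cells. Put $a_s=s$ for $0\le s\le m_1$, $b_t=t$ for $0\le t\le m_2$, and $Q_{s,t}=\mathbf{h}^{-1}((-\infty,a_s]\times(-\infty,b_t])=h_{M_1}^{-1}((-\infty,a_s])\cap h_{M_2}^{-1}((-\infty,b_t])$. The Euler characteristic surface of $\mathbf{h}$ is the $(m_1+1)\times(m_2+1)$ integer matrix with entries $\chi(Q_{s,t})$. The neighbourhood of a top-dimensional cube $C$ is the set of the $3^d-1$ other top-dimensional cubes of the grid that intersect it (with their faces), arranged as a $3\times3$ (or $3\times3\times3$) array centred at $C$. A boolean array of this shape, with central entry omitted and read in row order, is the binary representation of an integer $l$, $0\le l<2^{3^d-1}$; it specifies which neighbours are present. The entry $\mathit{preCompChanges}[l]$ is the change in Euler characteristic produced by adding $C$ and its faces when exactly the neighbours specified by $l$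 (with their faces) are present. Procedure $P$ (lists are indexed from $0$). (1) Add a one pixel (voxel) thick outer layer to the images, whose new pixels (voxels) are mapped by $\mathbf{h}$ to $(m_1+1,m_2+1)$. (2) Set $S_{\mathbf{h}}$ to the $(m_1+1)\times(m_2+1)$ zero matrix. (3) Main loop: for each top-dimensional cube $C$ of $Q$ (the cubes of the original images), do the following. (a) Let $a_s=h_{M_1}(C)$, $b_t=h_{M_2}(C)$, and let $neigh_1$, $neigh_2$ be the arrays of $h_{M_1}$ and $h_{M_2}$ values in the neighbourhood of $C$. (b) Let $thresholds_2$ be the list consisting of $b_t$, followed by the sorted values in $neigh_2$ greater than $b_t$, together with $m_2+1$ (as a set, without repetition). (c) Let $N_1^C$ be the boolean array defined by $neigh_1\le a_s$ at the positions before $C$ and by $neigh_1<a_s$ at the positions after $C$, in the row order. (d) For $k=1,\dots,|thresholds_2|-1$: let $N_2^C$ be the boolean array defined by $neigh_2\le thresholds_2[k-1]$; let $N^C$ be the element-wise AND of $N_1^C$ and $N_2^C$; let $l$ be the integer with binary representation $N^C$; for every $\hat t$ from the index of $thresholds_2[k-1]$ to the index of $thresholds_2[k]-1$, increase $S_{\mathbf{h}}[s][\hat t]$ by $\mathit{preCompChanges}[l]$. (4) Replace $S_{\mathbf{h}}$ by its cumulative sum on columns, i.e. $S_{\mathbf{h}}[s][t]$ becomes $\sum_{s'\le s}S_{\mathbf{h}}[s'][t]$. (5) Return $S_{\mathbf{h}}$. Running time is the number of elementary operations.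
   Formalization: The claim fails for general images; correctness is proved for all images with Q_{s,t} replaced by the union of top cubes C with h(C)≤(s,t), and for Q_{s,t} itself when on each cell both minima are attained at a common top cube; the time bound assumes n≥1 and m_2≥1. *)

(* Defs.v *)
(* Written for MathComp, with finmap for finite complexes. *)
From mathcomp Require Import all_boot all_order all_algebra finmap.

Set Implicit Arguments.
Unset Strict Implicit.
Unset Printing Implicit Defensive.

Local Open Scope fset_scope.
Local Open Scope nat_scope.

(** * Grids, cubes and Euler characteristic *)

Definition pixel := seq nat.

(* (k, true) is the unit interval [k, k+1] and (k, false) the point [k, k];
   a list of d of them is an elementary cube of R^d, namely their product. *)
Definition interval := (nat * bool)%type.
Definition cube := seq interval.

(* Lists the product of the lists in ls in lexicographic order. *)
Fixpoint list_product (T : Type) (ls : seq (seq T)) : seq (seq T) :=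
  if ls is l :: ls' then [seq x :: y | x <- l, y <- list_product ls']
  else [:: [::]].

(* All pixels of a grid of shape sh, in row order. *)
Definition grid (sh : seq nat) : seq pixel :=
  list_product [seq iota 0 k | k <- sh].

Definition top_cube (p : pixel) : cube := [seq (k, true) | k <- p].

Definition interval_faces (J : interval) : seq interval :=
  if J.2 then [:: (J.1, false); (J.1, true); (J.1.+1, false)] else [:: J].

(* All elementary cubes contained in c, including c itself. *)
Definition faces (c : cube) : seq cube :=
  list_product [seq interval_faces J | J <- c].

(* The top-dimensional cubes of the pixels in ps together with their faces. *)
Definition complex_of (ps : seq pixel) : {fset cube} :=
  [fset c in flatten [seq faces (top_cube p) | p <- ps]].

Definition cube_dim (c : cube) : nat := count snd c.

Definition euler (d : nat) (X : {fset cube}) : int :=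
  (\sum_(i < d.+1) (-1) ^+ i * #|` [fset c in X | cube_dim c == i]|%:Z)%R.

(** * Images and their bi-filtrations *)

(* An image of shape sh is read only at the pixels of grid sh. *)
Definition gray_image := pixel -> nat.

Definition intensities_le (sh : seq nat) (M : gray_image) (m : nat) : Prop :=
  forall p, p \in grid sh -> M p <= m.

Definition list_min (s : seq nat) : nat := foldr minn (head 0 s) s.

(* The pixel intensity filtering function h_M; on top_cube p it is M p, the
   only top-dimensional cube containing top_cube p being itself. *)
Definition filtering (sh : seq nat) (M : gray_image) (c : cube) : nat :=
  list_min [seq M p | p <- grid sh & c \in faces (top_cube p)].

(* Q_{s,t} = h_{M1}^{-1}(-oo, s] `&` h_{M2}^{-1}(-oo, t]. *)
Definition sublevel (sh : seq nat) (M1 M2 : gray_image) (s t : nat)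
    : {fset cube} :=
  [fset c in complex_of (grid sh) |
     (filtering sh M1 c <= s) && (filtering sh M2 c <= t)].

(* The cells lying in some top-dimensional cube C with h(C) <= (s, t). For a
   single image this is the sublevel set of the filtering function, but for two
   images it can be smaller than [sublevel]: the two minima defining h on a face
   may be attained only at different top-dimensional cubes. *)
Definition cube_sublevel (sh : seq nat) (M1 M2 : gray_image) (s t : nat)
    : {fset cube} :=
  complex_of [seq p <- grid sh | (M1 p <= s) && (M2 p <= t)].

(* On every cell c, h(c) is the minimum, for the product order, of the values of
   h on the top-dimensional cubes containing c. This holds exactly when
   [sublevel] and [cube_sublevel] agree at all (s, t). *)
Definition jointly_attained (sh : seq nat) (M1 M2 : gray_image) : Prop :=
  forall c, c \in complex_of (grid sh) ->
  exists p, [/\ p \in grid sh, c \in faces (top_cube p),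
                M1 p = filtering sh M1 c & M2 p = filtering sh M2 c].

Definition euler_surface (d m1 m2 : nat) (F : nat -> nat -> {fset cube})
    : 'M[int]_(m1.+1, m2.+1) :=
  \matrix_(s < m1.+1, t < m2.+1) euler d (F s t).

(** * Precomputed changes *)

(* The centre of the 3 x ... x 3 array is at [1, ..., 1]. *)
Definition centre (d : nat) : pixel := nseq d 1.

Definition neighbours (d : nat) : seq pixel :=
  [seq o <- grid (nseq d 3) | o != centre d].

(* Most significant digit first. *)
Definition binary_value (N : seq bool) : nat :=
  foldl (fun l (b : bool) => l.*2 + b) 0 N.

Definition is_preCompChanges (d : nat) (pre : seq int) : Prop :=
  size pre = 2 ^ (3 ^ d - 1) /\
  forall N : seq bool, size N = 3 ^ d - 1 ->
    let ps := mask N (neighbours d) in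
    (pre`_(binary_value N) =
       euler d (complex_of (centre d :: ps)) - euler d (complex_of ps))%R.

(** * Computations with a count of elementary operations *)

(* A result together with the number of elementary operations performed:
   arithmetic operations, comparisons and boolean operations on machine words,
   accesses to array or list cells, extensions of a list by one entry, and
   loop tests. *)
Definition timed (A : Type) : Type := (A * nat)%type.

Definition cost (A : Type) (k : nat) (x : A) : timed A := (x, k).

Definition bind (A B : Type) (m : timed A) (f : A -> timed B) : timed B :=
  let r := f m.1 in (r.1, m.2 + r.2).

Notation "'let*' x ':=' m 'in' f" := (bind m (fun x => f))
  (at level 200, x name, m at level 200, f at level 200,
   format "'[v' 'let*'  x  ':='  m  'in' '/' f ']'").

Fixpoint loop (I A : Type) (r : seq I) (body : I -> A -> timed A) (acc : A)
    : timed A :=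
  if r is i :: r' then
    let* _ := cost 1 tt in
    let* acc' := body i acc in
    loop r' body acc'
  else cost 1 acc.

Fixpoint map_timed (I A : Type) (f : I -> timed A) (r : seq I)
    : timed (seq A) :=
  if r is i :: r' then
    let* y := f i in
    let* ys := map_timed f r' in
    cost 2 (y :: ys)
  else cost 1 [::].

(* Arrays with w indices: one elementary operation per index. *)
Definition array (I : eqType) (V : Type) : Type := I -> V.

Definition read (w : nat) (I : eqType) (V : Type) (a : array I V) (i : I)
    : timed V :=
  cost w (a i).

Definition write (w : nat) (I : eqType) (V : Type) (a : array I V) (i : I)
    (v : V) : timed (array I V) :=
  cost w (fun j => if j == i then v else a j).

Definition table := array (nat * nat)%type int.

Definition matrix_of (m1 m2 : nat) (S : table) : 'M[int]_(m1.+1, m2.+1) :=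
  \matrix_(s < m1.+1, t < m2.+1) S (s : nat, t : nat).

(** * The procedure *)

(* Pixel p of the image becomes pixel p + (1, ..., 1) of the padded image, so
   that the values around p are found at p + o, for o in grid (nseq d 3). *)
Definition pad (d : nat) (sh : seq nat) (m : nat) (M : gray_image)
    : timed (array pixel nat) :=
  loop (grid [seq k.+2 | k <- sh]) (fun q a =>
    let* _ := cost d tt in
    let* inside := cost (3 * d) (all2 (fun x k => (0 < x) && (x <= k)) q sh) in
    let* v := (if inside
               then let* p := cost d [seq x.-1 | x <- q] in read d M p
               else cost 1 m.+1) in
    write d a q v) (fun=> 0).

Definition zero_table (m1 m2 : nat) : timed table :=
  loop (iota 0 m1.+1) (fun s S =>
    loop (iota 0 m2.+1) (fun t S => write 2 S (s, t) 0%R) S) (fun=> 0%R).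

Definition shift (p o : pixel) : pixel := [seq x.1 + x.2 | x <- zip p o].

Definition neigh (d : nat) (a : array pixel nat) (p : pixel)
    : timed (seq nat) :=
  map_timed (fun o => let* q := cost d (shift p o) in read d a q)
    (neighbours d).

(* Insertion in an increasing list without repetition. *)
Fixpoint insert (v : nat) (l : seq nat) : timed (seq nat) :=
  if l is x :: l' then
    let* lt := cost 2 (v < x) in
    if lt then cost 1 (v :: l) else
    let* eq := cost 1 (v == x) in
    if eq then cost 0 l else
    let* r := insert v l' in
    cost 1 (x :: r)
  else cost 1 [:: v].

Definition thresholds (m2 b : nat) (neigh2 : seq nat) : timed (seq nat) :=
  let* vs := loop neigh2 (fun v vs =>
               let* gt := cost 1 (b < v) in
               if gt then insert v vs else cost 0 vs) [::] in
  let* vs' := insert m2.+1 vs in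
  cost 1 (b :: vs').

(* In row order, (3 ^ d - 1) / 2 positions of the array precede its centre. *)
Definition compare1 (d a : nat) (neigh1 : seq nat) : timed (seq bool) :=
  map_timed (fun iv => cost 2 (if iv.1 < (3 ^ d - 1)./2 then iv.2 <= a
                               else iv.2 < a))
    (zip (iota 0 (size neigh1)) neigh1).

Definition binary_value_timed (N : seq bool) : timed nat :=
  loop N (fun (b : bool) l => cost 2 (l.*2 + b)) 0.

Definition process_cube (d m2 : nat) (pre : seq int) (a1 a2 : array pixel nat)
    (p : pixel) (S : table) : timed table :=
  let* c := cost d (shift p (centre d)) in
  let* a := read d a1 c in
  let* b := read d a2 c in
  let* neigh1 := neigh d a1 p in
  let* neigh2 := neigh d a2 p in
  let* thr := thresholds m2 b neigh2 in
  let* N1 := compare1 d a neigh1 in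
  loop (index_iota 1 (size thr)) (fun k S =>
    let* lo := cost 2 (nth 0 thr k.-1) in
    let* hi := cost 1 (nth 0 thr k) in
    let* N2 := map_timed (fun v => cost 1 (v <= lo)) neigh2 in
    let* N := map_timed (fun x => cost 1 (x.1 && x.2)) (zip N1 N2) in
    let* l := binary_value_timed N in
    let* change := cost 1 (pre`_l)%R in
    loop (index_iota lo hi) (fun t S =>
      let* x := read 2 S (a, t) in
      let* y := cost 1 (x + change)%R in
      write 2 S (a, t) y) S) S.

Definition main_loop (d : nat) (sh : seq nat) (m1 m2 : nat)
    (M1 M2 : gray_image) (pre : seq int) : timed table :=
  let* a1 := pad d sh m1 M1 in
  let* a2 := pad d sh m2 M2 in
  let* S := zero_table m1 m2 in
  loop (grid sh) (fun p S =>
    let* _ := cost d tt in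
    process_cube d m2 pre a1 a2 p S) S.

Definition cumulative_sum (m1 m2 : nat) (S : table) : timed table :=
  loop (iota 1 m1) (fun s S =>
    loop (iota 0 m2.+1) (fun t S =>
      let* x := read 3 S (s.-1, t) in
      let* y := read 2 S (s, t) in
      let* z := cost 1 (x + y)%R in
      write 2 S (s, t) z) S) S.

Definition procedure (d : nat) (sh : seq nat) (m1 m2 : nat)
    (M1 M2 : gray_image) (pre : seq int) : timed table :=
  let* S := main_loop d sh m1 m2 M1 M2 pre in
  cumulative_sum m1 m2 S.

Definition result (A : Type) (m : timed A) : A := m.1.
Definition running_time (A : Type) (m : timed A) : nat := m.2.

(** * Correctness with respect to a bi-filtration F *)

Definition correct_for (d m1 m2 : nat) (F : nat -> nat -> {fset cube})
    (Smain Sfinal : table) : Prop :=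
  [/\ forall s t, s <= m1 -> t <= m2 ->
        (Smain (s, t) =
           euler d (F s t) - euler d (if s is s'.+1 then F s' t else fset0))%R,
      forall s t, s <= m1 -> t <= m2 -> Sfinal (s, t) = euler d (F s t) &
      matrix_of m1 m2 Sfinal = euler_surface d m1 m2 F].

(* Main.v *)
Require Import Defs.
From mathcomp Require Import all_boot all_order all_algebra finmap.
From mathcomp Require Import zify.

(** Adding a top-dimensional cube C to a complex changes the Euler characteristic
    by the alternating count of the faces of C not yet present. This depends only
    on the neighbours of C and is translation invariant, so it is the tabulated
    value for the neighbours present. Passing from Q_{s-1,t} to Q_{s,t} adds, in
    row order, the cubes C with h_{M1}(C) = s and h_{M2}(C) <= t; when C is added,
    the neighbours present are those with h_{M2} <= t whose h_{M1} is < s, or = s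
    if they precede C. The changes thus telescope to chi(Q_{s,t}) - chi(Q_{s-1,t}).
    For fixed C they are constant in t between consecutive thresholds; the lengths
    of these ranges add up to at most m2 + 1, which bounds the work per cube. *)

Set Implicit Arguments.
Unset Strict Implicit.
Unset Printing Implicit Defensive.

Import Order.TTheory GRing.Theory.

Local Open Scope fset_scope.
Local Open Scope nat_scope.

(** * Grids and the Euler characteristic *)

(** Strict lexicographic order; on pixels of one size it is the row order. *)
Local Notation lexlt := (@Order.lt _ (seqlexi nat)).

Lemma mem_list_product (T : eqType) (ls : seq (seq T)) (c : seq T) :
  (c \in list_product ls) = all2 (fun x l => x \in l) c ls.
Proof.
elim: ls c => [|l ls IH] [|x c] //=.
  by apply/negP => /allpairsP [[y z] /= [_ _]].
apply/allpairsP/andP => [[[y z] /= [yl zl [-> ->]]]|[xl cl]].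
  by rewrite -IH.
by exists (x, c); split=> //=; rewrite IH.
Qed.

Lemma mem_grid (sh : seq nat) (p : pixel) : (p \in grid sh) = all2 ltn p sh.
Proof.
rewrite mem_list_product; elim: sh p => [|k sh IH] [|x p] //=.
by rewrite IH mem_iota.
Qed.

(** A face of [[k, k+1]] starts at [k] with either flag, or is the point [k+1]. Incidence thus
    becomes coordinatewise arithmetic. *)
Lemma mem_faces (c : cube) (p : pixel) :
  (c \in faces (top_cube p)) =
  all2 (fun J k => (J.1 == k) || (J.1 == k.+1) && ~~ J.2) c p.
Proof.
rewrite mem_list_product; elim: p c => [|k p IH] [|[x b] c] //=.
rewrite IH; congr (_ && _).
by case: b; rewrite /= ?inE !xpair_eqE ?andbT ?andbF ?orbF ?orbT.
Qed.

Lemma uniq_list_product (T : eqType) (ls : seq (seq T)) :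
  all uniq ls -> uniq (list_product ls).
Proof.
elim: ls => [//|l ls IH] /= /andP [ul /IH uls].
by apply: allpairs_uniq => // -[x y] [x' y'] _ _ [-> ->].
Qed.

Lemma uniq_faces (p : pixel) : uniq (faces (top_cube p)).
Proof.
apply: uniq_list_product; rewrite /top_cube -map_comp all_map.
by apply/allP => k _ /=; rewrite !inE !xpair_eqE (ltn_eqF (ltnSn k)) !andbF.
Qed.

Lemma size_grid (sh : seq nat) : size (grid sh) = \prod_(k <- sh) k.
Proof.
rewrite /grid; elim: sh => [|k sh IH] /=; first by rewrite big_nil.
by rewrite big_cons size_allpairs size_iota IH.
Qed.

Lemma size_mem_grid (sh : seq nat) (p : pixel) : p \in grid sh -> size p = size sh.
Proof. by rewrite mem_grid all2E => /andP [/eqP]. Qed.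

Lemma grid_sorted (sh : seq nat) : pairwise lexlt (grid sh).
Proof.
rewrite /grid; elim: sh => [//|k sh IH] /=.
(* The start of [iota] is generalised from 0 to [m], so that removing the first block leaves an
   instance of the same claim. *)
move: (map _ sh) IH => ls IH; elim: k 0 => [//|k IHk] m /=.
rewrite pairwise_cat pairwise_map IHk andbT; apply/andP; split.
  apply/allrelP => _ _ /mapP [y _ ->] /allpairsP [[x z] /= [xi _ ->]].
  move: xi; rewrite mem_iota => /andP [mx _].
  by rewrite ltxi_cons !leEnat (ltnW mx) leqNgt mx.
apply: sub_pairwise IH => y z /= yz.
by rewrite ltxi_cons lexx.
Qed.

(** * Translations of pixels and cubes *)

Definition translate (v : pixel) (c : cube) : cube :=
  [seq (x.1 + x.2.1, x.2.2) | x <- zip v c].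

Lemma shiftC (p q : pixel) : shift p q = shift q p.
Proof.
by elim: p q => [|x p IH] [|y q] //; rewrite /shift /= addnC -/(shift p q) IH.
Qed.

Lemma lexlt_shift (v p q : pixel) : size p = size v -> size q = size v ->
  lexlt (shift v p) (shift v q) = lexlt p q.
Proof.
elim: v p q => [|x v IH] [|y p] [|z q] //= [sp] [sq].
by rewrite /shift /= !ltxi_cons -/(shift v p) -/(shift v q) IH // !leEnat !leq_add2l.
Qed.

Lemma shift_inj (v p q : pixel) : size p = size v -> size q = size v ->
  shift v p = shift v q -> p = q.
Proof.
elim: v p q => [|x v IH] [|y p] [|z q] //= [sp] [sq].
by rewrite /shift /= => -[] /addnI -> /IH ->.
Qed.

Lemma size_face (c : cube) (p : pixel) :
  c \in faces (top_cube p) -> size c = size p.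
Proof. by rewrite mem_faces all2E => /andP [/eqP]. Qed.

Lemma mem_faces_translate (v p : pixel) (c : cube) :
  size p = size v -> size c = size v ->
  (translate v c \in faces (top_cube (shift v p))) = (c \in faces (top_cube p)).
Proof.
rewrite !mem_faces.
elim: v p c => [|x v IH] [|y p] [|[z b] c] //= [sp] [sc].
rewrite IH // -addnS !eqn_add2l; by [].
Qed.

(** An equality of lists, so that sums over faces can be reindexed. *)
Lemma faces_translate (v p : pixel) : size p = size v ->
  faces (top_cube (shift v p)) = map (translate v) (faces (top_cube p)).
Proof.
rewrite /faces; elim: v p => [|x v IH] [|y p] // [sp].
have e : list_product [seq interval_faces J | J <- top_cube (shift v p)] =
  map (translate v) (list_product [seq interval_faces J | J <- top_cube p]) by exact: IH.
by rewrite /= e !map_cat -!map_comp -addnS.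
Qed.

Lemma cube_dim_translate (v : pixel) (c : cube) : size c = size v ->
  cube_dim (translate v c) = cube_dim c.
Proof.
rewrite /cube_dim; elim: v c => [|x v IH] [|[y b] c] //= [sc].
by rewrite -(IH c sc).
Qed.

(** * Complexes and the change caused by one more cube *)

Lemma mem_complex (ps : seq pixel) (c : cube) :
  (c \in complex_of ps) = has (fun p => c \in faces (top_cube p)) ps.
Proof.
rewrite /complex_of in_fset /=; apply/flatten_mapP/hasP => -[p]; by exists p.
Qed.

Lemma eq_complex (ps qs : seq pixel) : ps =i qs -> complex_of ps = complex_of qs.
Proof. by move=> e; apply/fsetP => c; rewrite !mem_complex; apply: eq_has_r. Qed.

Lemma complex_nil : complex_of [::] = fset0.
Proof. by apply/fsetP => c; rewrite mem_complex in_fset0. Qed.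

(** After exchanging the two sums, each cell meets the single index [i] equal to its dimension; the
    bound by [d] puts that index in range. *)
Lemma euler_sum (d : nat) (X : {fset cube}) :
  (forall c, c \in X -> cube_dim c <= d) ->
  euler d X = (\sum_(c <- X) (-1) ^+ cube_dim c)%R.
Proof.
move=> dX; rewrite /euler.
transitivity (\sum_(i < d.+1) \sum_(c <- X | cube_dim c == i) (-1) ^+ i : int)%R.
  apply: eq_bigr => i _.
  rewrite big_const_seq iter_addr_0 -mulr_natr natz; congr (_ * _%:Z)%R.
  rewrite -size_filter; apply/perm_size/uniq_perm; rewrite ?fset_uniq ?filter_uniq ?fset_uniq //.
  by move=> c; rewrite !inE mem_filter andbC.
rewrite (exchange_big_dep predT) //= big_seq [RHS]big_seq.
apply: eq_bigr => c /dX cd.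
by rewrite (big_pred1 (inord (cube_dim c))) => [|i /=]; rewrite ?inordK // -val_eqE /= inordK // eq_sym.
Qed.

Lemma cube_dim_complex (d : nat) (ps : seq pixel) (c : cube) :
  (forall p, p \in ps -> size p = d) -> c \in complex_of ps -> cube_dim c <= d.
Proof.
move=> sp; rewrite mem_complex => /hasP [p /sp <-] /size_face <-.
exact: count_size.
Qed.

(** The change in Euler characteristic when [p] joins [ps], in a form that makes locality and
    translation invariance visible. *)
Definition change (p : pixel) (ps : seq pixel) : int :=
  (\sum_(c <- faces (top_cube p) | c \notin complex_of ps) (-1) ^+ cube_dim c)%R.

(** The cells of the larger complex split disjointly into the old ones and the faces of [p] not yet
    covered. *)
Lemma euler_cons (d : nat) (p : pixel) (ps : seq pixel) :
  (forall q, q \in p :: ps -> size q = d) ->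
  (euler d (complex_of (p :: ps)) - euler d (complex_of ps) = change p ps)%R.
Proof.
move=> sp.
rewrite !euler_sum; first last.
- by move=> c; apply: cube_dim_complex.
- by move=> c; apply: cube_dim_complex => q qs; apply: sp; rewrite inE qs orbT.
have e : perm_eq (complex_of (p :: ps)) (complex_of ps ++
    [seq c <- faces (top_cube p) | c \notin complex_of ps]).
  apply: uniq_perm; rewrite ?fset_uniq //.
    rewrite cat_uniq fset_uniq filter_uniq ?uniq_faces // andbT.
    by apply/hasPn => c; rewrite mem_filter => /andP [].
  move=> c; rewrite mem_cat mem_filter !mem_complex /= orbC.
  by case: (has _ ps); rewrite ?orbT ?orbF.
by rewrite (perm_big _ e) big_cat big_filter /= addrAC subrr add0r.
Qed.

Lemma change_translate (v p : pixel) (ps : seq pixel) :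
  (forall q, q \in p :: ps -> size q = size v) ->
  change (shift v p) (map (shift v) ps) = change p ps.
Proof.
move=> sp; have sp0 := sp p (mem_head _ _).
rewrite /change faces_translate // big_map big_seq_cond [RHS]big_seq_cond.
apply: congr_big => // c.
- case: (boolP (c \in faces _)) => //= cf; congr negb.
  rewrite !mem_complex has_map; apply: eq_in_has => q qs /=.
  by rewrite mem_faces_translate ?(size_face cf) // sp // inE qs orbT.
- by move=> /andP [/size_face cf _]; rewrite cube_dim_translate // cf.
Qed.

Lemma eq_change (p : pixel) (ps qs : seq pixel) :
  (forall c, c \in faces (top_cube p) ->
     (c \in complex_of ps) = (c \in complex_of qs)) ->
  change p ps = change p qs.
Proof.
move=> e; rewrite /change big_seq_cond [RHS]big_seq_cond; apply: eq_bigl => c.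
by case: (boolP (c \in _)) => //= cf; rewrite e.
Qed.

(** Telescoping: the pixels of [g] in [A] join [ps] one by one in row order. The induction removes
    the last pixel of [g]. *)
Lemma euler_cat_sorted (d : nat) (A : pred pixel) (g ps : seq pixel) :
  (forall q, q \in g ++ ps -> size q = d) -> pairwise lexlt g ->
  (euler d (complex_of (ps ++ filter A g)) - euler d (complex_of ps) =
   \sum_(p <- g | A p) change p (ps ++ [seq q <- g | A q & lexlt q p]))%R.
Proof.
elim/last_ind: g => [|g p IH] sg; first by rewrite cats0 subrr big_nil.
rewrite pairwise_rcons => /andP [/allP gp sortg].
(* The pixel [p] is the largest, so it never counts as preceding a pixel of [g], and the earlier
   terms of the sum are unaffected by it. *)
have ngt q : q \in g -> lexlt p q = false.
  by move/gp => qp; apply/negbTE/negP => pq; move: (lt_trans pq qp); rewrite ltxx.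
have {}IH : _ := IH _ sortg.
rewrite -cats1 big_cat big_mkcond /= big_cons big_nil cats1 !filter_rcons ltxx andbF -big_mkcond /=.
have -> : [seq q <- g | A q & lexlt q p] = filter A g.
  by apply: eq_in_filter => q /gp ->; rewrite andbT.
have e : (\sum_(q <- g | A q) change q (ps ++ [seq q' <- rcons g p | A q' & lexlt q' q])
  = euler d (complex_of (ps ++ filter A g)) - euler d (complex_of ps))%R.
  rewrite IH => [|q qg]; last first.
    by apply: sg; move: qg; rewrite !mem_cat mem_rcons inE => /orP [->|->]; rewrite ?orbT.
  rewrite big_seq_cond [RHS]big_seq_cond; apply: eq_bigr => q /andP [qg _].
  by rewrite filter_rcons ngt // andbF.
rewrite [X in (_ = X + _)%R]e addr0.
case: (boolP (A p)) => Ap; last by rewrite addr0.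
rewrite -(@euler_cons d) => [|q]; last first.
  rewrite !inE mem_cat mem_filter => qs; apply: sg; rewrite mem_cat mem_rcons inE.
  by case/or3P: qs => [->|->|/andP [_ ->]]; rewrite ?orbT.
rewrite (@eq_complex (ps ++ rcons (filter A g) p) (p :: ps ++ filter A g)).
  by rewrite [RHS]addrC addrA subrK.
by move=> q; rewrite inE !mem_cat mem_rcons inE orbCA.
Qed.

(** * The neighbourhood of a pixel in the padded image *)

(** Closed form of the array built by [pad], valid on the padded grid. The image occupies
    coordinates [1..k] in each direction. *)
Definition padded (sh : seq nat) (m : nat) (M : gray_image) (q : pixel) : nat :=
  if all2 (fun x k => (0 < x) && (x <= k)) q sh then M [seq x.-1 | x <- q]
  else m.+1.

Lemma size_centre (d : nat) : size (centre d) = d.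
Proof. exact: size_nseq. Qed.

Lemma padded_shift (sh : seq nat) (m : nat) (M : gray_image) (q : pixel) :
  q \in grid sh -> padded sh m M (shift (centre (size sh)) q) = M q.
Proof.
rewrite mem_grid /padded => qsh.
have [-> ->] : all2 (fun x k => (0 < x) && (x <= k)) (shift (centre (size sh)) q) sh
  /\ [seq x.-1 | x <- shift (centre (size sh)) q] = q; last by [].
elim: sh q qsh => [|k sh IH] [|x q] //= /andP [xk /IH [h1 h2]].
by rewrite /shift /= add1n /= xk -/(shift _ _) h1 h2.
Qed.

Lemma padded_inside (sh : seq nat) (m : nat) (M : gray_image) (q : pixel) :
  padded sh m M q != m.+1 ->
  exists2 p, p \in grid sh & q = shift (centre (size sh)) p.
Proof.
rewrite /padded; case: ifP => [qsh _|_]; last by rewrite eqxx.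
exists [seq x.-1 | x <- q].
  rewrite mem_grid; elim: sh q qsh => [|k sh IH] [|[|x] q] //= /andP [/= xk /IH ->].
  by rewrite xk.
elim: sh q qsh => [|k sh IH] [|[|x] q] //= /andP [/= xk /IH {1}->].
by rewrite /shift /= add1n.
Qed.

Lemma padded_le (sh : seq nat) (m : nat) (M : gray_image) (q : pixel) :
  intensities_le sh M m -> padded sh m M q <= m.+1.
Proof.
move=> Mm; have [-> //|/padded_inside [p psh ->]] := eqVneq (padded sh m M q) m.+1.
by rewrite padded_shift // leqW // Mm.
Qed.

Lemma shift_grid (sh : seq nat) (p o : pixel) :
  p \in grid sh -> o \in grid (nseq (size sh) 3) ->
  shift p o \in grid [seq k.+2 | k <- sh].
Proof.
rewrite !mem_grid.
elim: sh p o => [|k sh IH] [|x p] [|y o] //= /andP [xk psh] /andP [yk osh].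
by rewrite IH //; lia.
Qed.

(** Unit cubes sharing a cell differ by at most 1 in each coordinate, so only the cubes of the 3 x
    ... x 3 array can touch the central one. *)
Lemma adjacent_offset (p r : pixel) (c : cube) :
  c \in faces (top_cube (shift (centre (size p)) p)) ->
  c \in faces (top_cube r) ->
  exists2 o, o \in grid (nseq (size p) 3) & r = shift p o.
Proof.
have e : forall l, (l \in grid (nseq (size p) 3)) = all2 ltn l (nseq (size p) 3).
  by move=> l; rewrite mem_grid.
rewrite !mem_faces => cp cr.
(* The subtraction is not truncated: each coordinate of [r] exceeds that of [p] by 0, 1 or 2. *)
exists [seq x.1 - x.2 | x <- zip r p].
  rewrite e; elim: p r c cp cr {e} => [|x p IH] [|y r] [|[z b] c] //=.
  move=> /andP [h1 /IH h2] /andP [h3 /h2 ->]; rewrite andbT.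
  by move: h1 h3; rewrite /= add1n; lia.
elim: p r c cp cr {e} => [|x p IH] [|y r] [|[z b] c] //=.
move=> /andP [h1 /IH h2] /andP [h3 /h2 {1}->]; rewrite /shift /=; congr (_ :: _).
by move: h1 h3; rewrite /= add1n; lia.
Qed.

(** The state of column [t] when [p] is added, if pixels enter by increasing [M1] with ties broken
    by row order. *)
Definition earlier (sh : seq nat) (M1 M2 : gray_image) (t : nat) (p q : pixel) :=
  ((M1 q < M1 p) || ((M1 q == M1 p) && lexlt q p)) && (M2 q <= t).

(** The bit of $N^C$ at offset [o], with the position before or after the centre expressed by the
    order on offsets. *)
Definition present (sh : seq nat) (m1 m2 : nat) (M1 M2 : gray_image) (t : nat)
    (p o : pixel) :=
  (if lexlt o (centre (size sh)) then padded sh m1 M1 (shift p o) <= M1 p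
   else padded sh m1 M1 (shift p o) < M1 p) && (padded sh m2 M2 (shift p o) <= t).

Lemma size_neighbour (d : nat) (o : pixel) : o \in neighbours d -> size o = d.
Proof. by rewrite mem_filter => /andP [_ /size_mem_grid ->]; rewrite size_nseq. Qed.

(** Translating the array by [p] and the image by the centre puts both central cubes at the same
    place. Only cells of that cube matter, and every cube containing one of them lies in the
    array. *)
Lemma change_local (sh : seq nat) (m1 m2 t : nat) (M1 M2 : gray_image) (p : pixel) :
  intensities_le sh M1 m1 -> p \in grid sh -> t <= m2 ->
  change (centre (size sh))
    (filter (present sh m1 m2 M1 M2 t p) (neighbours (size sh))) =
  change p (filter (earlier sh M1 M2 t p) (grid sh)).
Proof.
set d := size sh => Mm psh tm; have sp : size p = d := size_mem_grid psh.
rewrite -(@change_translate p); last first.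
  move=> q; rewrite inE mem_filter => /orP [/eqP ->|/andP [_ /size_neighbour ->]] //.
  by rewrite size_centre.
rewrite -(@change_translate (centre d) p); last first.
  move=> q; rewrite inE mem_filter size_centre.
  by move=> /orP [/eqP ->|/andP [_ /size_mem_grid]].
have sc : size (centre d) = size p by rewrite size_centre.
rewrite shiftC; apply: eq_change => c cp; rewrite !mem_complex !has_map.
apply/hasP/hasP => -[o]; rewrite mem_filter => /andP [].
  rewrite mem_filter => /andP [on1 on2] /andP [onc og] /= co.
  have so : size o = size p by rewrite (size_mem_grid og) size_nseq.
  (* A value at most [t] in the second image is not the padding value [m2.+1], so the neighbour is a
     genuine pixel [q]. *)
  have [q qsh e] : exists2 q, q \in grid sh & shift p o = shift (centre d) q.
    by apply: (@padded_inside sh m2 M2); rewrite ltn_eqF // ltnS (leq_trans on2 tm).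
  have sq := size_mem_grid qsh.
  exists q; last by rewrite /= -e.
  rewrite mem_filter qsh andbT /earlier; move: on1 on2.
  rewrite e !padded_shift // => on1 ->; rewrite andbT.
  (* Row order is translation invariant: [q] precedes [p] exactly when [o] precedes the centre. *)
  rewrite -(@lexlt_shift (centre d)) ?size_centre //.
  rewrite -e [shift (centre d) p]shiftC lexlt_shift //.
  by case: ifP on1 => _; rewrite ?andbT ?andbF ?orbF // leq_eqVlt orbC.
(* Conversely, [o] now names a pixel of the image and [q] its offset in the array around [p]. *)
move=> /andP [on1 on2] osh /= co.
have so := size_mem_grid osh.
have [q qg e] : exists2 q, q \in grid (nseq (size p) 3) & shift (centre d) o = shift p q.
  by apply: adjacent_offset co; rewrite sp.
have sq : size q = size p by rewrite (size_mem_grid qg) size_nseq.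
exists q; last by rewrite /= -e.
rewrite mem_filter /present -e !padded_shift // on2 andbT.
rewrite -(@lexlt_shift p) // -e [shift p _]shiftC lexlt_shift ?size_centre //.
apply/andP; split.
  by case: ifP on1 => _; rewrite ?andbT ?andbF ?orbF // orbC -leq_eqVlt.
(* The centre is not among the neighbours; it is excluded because [p] is not earlier than itself. *)
rewrite mem_filter -sp qg andbT; apply/eqP => qc.
have op : o = p.
  by apply: (@shift_inj (centre d)); rewrite ?size_centre // e qc sp shiftC.
by move: on1; rewrite op !ltnn ltxx andbF.
Qed.

(** * Results and costs of the steps *)

Lemma result_bind (A B : Type) (m : timed A) (f : A -> timed B) :
  (bind m f).1 = (f m.1).1.
Proof. by []. Qed.

Lemma time_bind (A B : Type) (m : timed A) (f : A -> timed B) :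
  (bind m f).2 = m.2 + (f m.1).2.
Proof. by []. Qed.

Lemma result_loop (I A : Type) (r : seq I) (body : I -> A -> timed A) (x : A) :
  (loop r body x).1 = foldl (fun x i => (body i x).1) x r.
Proof. by elim: r x => [//|i r IH] x /=. Qed.

(** The bound [T] is uniform in the accumulator. The successor counts the test of each round, the
    final 1 the test that ends the loop. *)
Lemma time_loop (I : eqType) (A : Type) (r : seq I) (body : I -> A -> timed A)
    (T : I -> nat) (x : A) :
  (forall i y, i \in r -> (body i y).2 <= T i) ->
  (loop r body x).2 <= \sum_(i <- r) (T i).+1 + 1.
Proof.
elim: r x => [|i r IH] x bT /=; first by rewrite big_nil.
rewrite big_cons add1n addSn addSn -addnA ltnS; apply: leq_add.
  by apply: bT; rewrite mem_head.
by apply: IH => j y jr; apply: bT; rewrite inE jr orbT.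
Qed.

Lemma time_loop_const (I : eqType) (A : Type) (r : seq I)
    (body : I -> A -> timed A) (k : nat) (x : A) :
  (forall i y, i \in r -> (body i y).2 <= k) ->
  (loop r body x).2 <= k.+1 * size r + 1.
Proof.
move=> /(@time_loop I A r body (fun=> k) x).
by rewrite big_const_seq count_predT iter_addn_0.
Qed.

Lemma result_map_timed (I A : Type) (f : I -> timed A) (r : seq I) :
  (map_timed f r).1 = [seq (f i).1 | i <- r].
Proof. by elim: r => [//|i r IH] /=; rewrite IH. Qed.

Lemma time_map_timed (I A : Type) (f : I -> timed A) (r : seq I) (k : nat) :
  (forall i, (f i).2 = k) -> (map_timed f r).2 = k.+2 * size r + 1.
Proof.
move=> fk; elim: r => [|i r IH] /=; first by rewrite muln0.
by rewrite IH fk; lia.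
Qed.

Lemma result_pad (d : nat) (sh : seq nat) (m : nat) (M : gray_image) (q : pixel) :
  (pad d sh m M).1 q =
  if q \in grid [seq k.+2 | k <- sh] then padded sh m M q else 0.
Proof.
rewrite /pad result_loop.
set f := fun _ _ => _.
have ef a i j : f a i j = if j == i then padded sh m M i else a j.
  by rewrite /f /padded /=; case: all2.
(* The value written at an index does not depend on the accumulator, so the claim generalises to any
   list and any initial array. *)
suff h r a : foldl f a r q =
  if q \in r then padded sh m M q else a q by rewrite h.
elim: r a => [//|i r IH] a /=; rewrite IH ef inE.
by case: eqVneq => [->|] //=; case: ifP.
Qed.

Lemma time_pad (d : nat) (sh : seq nat) (m : nat) (M : gray_image) :
  (pad d sh m M).2 <= (7 * d).+2 * size (grid [seq k.+2 | k <- sh]) + 1.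
Proof.
by apply: time_loop_const => q a _; rewrite !time_bind /=; case: all2 => /=; lia.
Qed.

Lemma result_zero_table (m1 m2 : nat) (x : nat * nat) : (zero_table m1 m2).1 x = 0%R.
Proof.
have h (r : seq nat) (f : table -> nat -> table) (S : table) :
    (forall S i, S x = 0%R -> f S i x = 0%R) -> S x = 0%R -> foldl f S r x = 0%R.
  by move=> hf; elim: r S => [//|i r IH] S Sx /=; apply/IH/hf.
rewrite /zero_table result_loop; apply: (h) => // S s Sx.
by rewrite result_loop; apply: h => // S' t Sx' /=; case: ifP.
Qed.

Lemma time_zero_table (m1 m2 : nat) :
  (zero_table m1 m2).2 <= (3 * m2.+1 + 2) * m1.+1 + 1.
Proof.
have h (s : nat) (S : table) : (loop (iota 0 m2.+1) (fun t S => write 2 S (s, t) (0%R : int)) S).2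
    <= 3 * m2.+1 + 1.
  by rewrite -[in leqRHS](size_iota 0 m2.+1); exact: time_loop_const.
have := @time_loop_const _ _ (iota 0 m1.+1) _ _ (fun=> 0%R) (fun s S _ => h s S).
by rewrite size_iota => le; apply: leq_trans le _; lia.
Qed.

(** * The list of thresholds *)

Lemma mem_insert (v : nat) (l : seq nat) : (insert v l).1 =i v :: l.
Proof.
elim: l => [//|x l IH] /=; case: ltnP => //= _; case: eqVneq => [->|_] /= y.
  by rewrite !inE; case: (y == x).
by rewrite inE IH !inE orbCA.
Qed.

Lemma insert_sorted (b v : nat) (l : seq nat) :
  b < v -> path ltn b l -> path ltn b (insert v l).1.
Proof.
elim: l b => [|x l IH] b bv /=; first by rewrite bv.
move=> /andP [bx xl]; case: ltnP => [vx|xv] /=; first by rewrite bv vx.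
case: eqVneq => [_|vx] /=; rewrite bx //; apply: IH => //.
by rewrite ltn_neqAle eq_sym vx.
Qed.

Lemma size_insert (v : nat) (l : seq nat) : size (insert v l).1 <= (size l).+1.
Proof.
by elim: l => [//|x l IH] /=; case: ltnP => //= _; case: eqVneq.
Qed.

Lemma time_insert (v : nat) (l : seq nat) : (insert v l).2 <= 4 * size l + 1.
Proof.
elim: l => [//|x l IH] /=; case: ltnP => /= _; first by lia.
by case: eqVneq => /= _; lia.
Qed.

Lemma path_ltn_last (b v : nat) (l : seq nat) :
  path ltn b l -> v \in b :: l -> v <= last b l.
Proof.
elim: l b v => [|x l IH] b v /=; first by rewrite inE => _ /eqP ->.
move=> /andP [bx xl]; rewrite inE => /orP [/eqP ->|/(IH _ _ xl) //].
by apply: leq_trans (ltnW bx) (IH _ _ xl (mem_head _ _)).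
Qed.

(** Order, last entry and membership serve the correctness of the updates; order, last entry and
    length serve the time bound. *)
Lemma thresholds_spec (m2 b : nat) (neigh2 : seq nat) :
  b <= m2 -> all (leq^~ m2.+1) neigh2 ->
  exists l, [/\ (thresholds m2 b neigh2).1 = b :: l, path ltn b l,
    last b l = m2.+1, {in neigh2, forall v, b < v -> v \in l} &
    size l <= (size neigh2).+1].
Proof.
move=> bm nm; rewrite /thresholds !result_bind /= result_loop.
set vs := foldl _ _ _.
pose f vs v := (if b < v then insert v vs else cost 0 vs).1.
have vsE : vs = foldl f [::] neigh2 by [].
have [vsort vmem vsize] : [/\ path ltn b vs,
    vs =i filter (ltn b) neigh2 & size vs <= size neigh2].
  rewrite vsE {vs vsE nm}; elim/last_ind: neigh2 => [//|r v [IH1 IH2 IH3]].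
  rewrite foldl_rcons filter_rcons size_rcons /f /=.
  case: ifP => [bv|_]; last by split=> //; rewrite leqW.
  split; first exact: insert_sorted.
    by move=> x; rewrite mem_insert mem_rcons !inE IH2.
  exact: leq_trans (size_insert _ _) _.
have vs_le : {in vs, forall v, v <= m2.+1}.
  by move=> v; rewrite vmem mem_filter => /andP [_ /(allP nm)].
exists (insert m2.+1 vs).1; split=> //.
- exact: insert_sorted.
(* The last entry is at least [m2.+1] because this value occurs in an increasing list, and at most
   [m2.+1] because every entry is. *)
- apply/anti_leq/andP; split; last first.
    by apply: path_ltn_last; rewrite ?insert_sorted // inE mem_insert mem_head orbT.
  have := mem_last b (insert m2.+1 vs).1.
  by rewrite inE mem_insert inE => /or3P [/eqP ->|/eqP ->|/vs_le //]; rewrite // leqW.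
- by move=> v vn bv; rewrite mem_insert inE vmem mem_filter /= bv vn orbT.
- exact: leq_trans (size_insert _ _) _.
Qed.

Lemma time_thresholds (m2 b : nat) (neigh2 : seq nat) :
  (thresholds m2 b neigh2).2 <= (4 * size neigh2 + 3) * (size neigh2).+1 + 2.
Proof.
pose body := fun v l => let* gt := cost 1 (b < v) in if gt then insert v l else cost 0 l.
have size_body (v : nat) (vs : seq nat) : size (body v vs).1 <= (size vs).+1.
  by rewrite /body result_bind /=; case: ifP => _ //; exact: size_insert.
have time_body (v : nat) (vs : seq nat) : (body v vs).2 <= 4 * size vs + 2.
  by rewrite /body time_bind /=; case: ifP => _ /=; have := time_insert v vs; lia.
(* An insertion costs as much as the current list is long, so time and length are bounded
   together. *)
have h : forall r vs, size vs + size r <= size neigh2 ->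
    (loop r body vs).2 <= (4 * size neigh2 + 3) * size r + 1 /\
    size (loop r body vs).1 <= size vs + size r.
  elim=> [|v r IH] vs //= sn; first by rewrite addn0 muln0.
  have := size_body v vs; have := time_body v vs.
  have := IH (body v vs).1; rewrite /bind /=; lia.
have [] := h neigh2 [::] (leqnn _).
have := time_insert m2.+1 (loop neigh2 body [::]).1.
rewrite /thresholds !time_bind -/body /=; lia.
Qed.

(** Each iteration adds to the entry [x] an amount independent of the table. All three nested loops
    over the table have this form. *)
Lemma foldl_add (I : eqType) (r : seq I) (f : table -> I -> table)
    (g : I -> int) (x : nat * nat) (S : table) :
  (forall S i, i \in r -> f S i x = S x + g i)%R ->
  (foldl f S r x = S x + \sum_(i <- r) g i)%R.
Proof.
elim: r S => [|i r IH] S fg /=; first by rewrite big_nil addr0.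
rewrite IH => [|S' j jr]; last by apply: fg; rewrite inE jr orbT.
by rewrite fg ?mem_head // big_cons addrA.
Qed.

(** * Updates of the table over the ranges between thresholds *)

Definition add_range (a : nat) (v : int) (lo hi : nat) (S : table) : timed table :=
  loop (index_iota lo hi) (fun t S =>
    let* x := read 2 S (a, t) in
    let* y := cost 1 (x + v)%R in
    write 2 S (a, t) y) S.

Lemma result_add_range (a : nat) (v : int) (lo hi : nat) (S : table) (s t : nat) :
  ((add_range a v lo hi S).1 (s, t) =
   S (s, t) + if (s == a) && (lo <= t < hi)%N then v else 0)%R.
Proof.
rewrite /add_range result_loop (@foldl_add _ _ _
  (fun t' => if (s, t) == (a, t') then v else 0%R)); last first.
  by move=> S' t' _ /=; case: eqP => [->|]; rewrite ?addr0.
congr (_ + _)%R; rewrite -mem_index_iota -big_mkcond /=.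
case: (eqVneq s a) => [->|ns] /=; last first.
  by rewrite big_pred0 // => t'; rewrite xpair_eqE (negbTE ns).
case: ifP => [tr|/negP tr].
  rewrite (big_rem t) //= eqxx big_seq_cond big_pred0 ?addr0 // => t'.
  rewrite mem_rem_uniq ?iota_uniq // inE xpair_eqE eqxx /= [t == t']eq_sym.
  by case: (t' == t); rewrite ?andbF.
rewrite big_seq_cond big_pred0 // => t'; rewrite xpair_eqE eqxx /=.
by apply/negP => /andP [h /eqP e]; rewrite e in tr.
Qed.

Lemma time_add_range (a : nat) (v : int) (lo hi : nat) (S : table) :
  (add_range a v lo hi S).2 <= 6 * (hi - lo) + 1.
Proof. by rewrite -(size_iota lo (hi - lo)); apply: time_loop_const. Qed.

(** The general monoid serves both the sum of integer updates and the sum of the lengths of the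
    ranges. *)
Lemma big_consecutive (R : Type) (idx : R) (op : Monoid.law idx)
    (G : nat -> nat -> R) (x y : nat) (l : seq nat) :
  \big[op/idx]_(1 <= k < size [:: x, y & l])
     G (nth 0 [:: x, y & l] k.-1) (nth 0 [:: x, y & l] k) =
  op (G x y) (\big[op/idx]_(1 <= k < size (y :: l))
     G (nth 0 (y :: l) k.-1) (nth 0 (y :: l) k)).
Proof.
rewrite big_ltn //; congr (op _ _).
rewrite big_add1; apply: eq_big_nat => k /andP [k0 _].
by case: k k0.
Qed.

(** The half-open ranges partition the interval from [x] to [last x l], so at most one term is
    nonzero. *)
Lemma sum_consecutive_ranges (x t : nat) (v : int) (l : seq nat) :
  path ltn x l ->
  (\sum_(1 <= k < size (x :: l))
     (if (nth 0 (x :: l) k.-1 <= t < nth 0 (x :: l) k)%N then v else 0) =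
   if (x <= t < last x l)%N then v else 0)%R.
Proof.
elim: l x => [|y l IH] x; first by rewrite big_geq //= ltnNge andbN.
move=> /= /andP [xy yl]; have yl' := path_ltn_last yl (mem_head _ _).
rewrite (big_consecutive _ (fun a b => if (a <= t < b)%N then v else 0%R)) /= IH //.
by case: (leqP x t) => xt; case: (leqP y t) => yt /=; rewrite ?addr0 ?add0r //; case: ifP; lia.
Qed.

(** Telescoping, without truncation since the list increases. This keeps the work per cube linear in
    [m2]. *)
Lemma sum_consecutive_gaps (x : nat) (l : seq nat) :
  path ltn x l ->
  \sum_(1 <= k < size (x :: l)) (nth 0 (x :: l) k - nth 0 (x :: l) k.-1) =
  last x l - x.
Proof.
elim: l x => [|y l IH] x; first by rewrite big_geq //= subnn.
move=> /= /andP [xy yl]; have yl' := path_ltn_last yl (mem_head _ _).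
rewrite (big_consecutive _ (fun a b => b - a)) /= IH //; lia.
Qed.

Definition comparison1 (d a : nat) (neigh1 : seq nat) : seq bool :=
  [seq if iv.1 < (3 ^ d - 1)./2 then iv.2 <= a else iv.2 < a
     | iv <- zip (iota 0 (size neigh1)) neigh1].

Definition neighbourhood (N1 : seq bool) (neigh2 : seq nat) (t : nat) :=
  [seq x.1 && x.2 | x <- zip N1 [seq v <= t | v <- neigh2]].

Definition neigh_values (d : nat) (a : array pixel nat) (p : pixel) : seq nat :=
  [seq a (shift p o) | o <- neighbours d].

(** The body of the threshold loop, kept convertible to the one in [process_cube]. *)
Definition process_range (pre : seq int) (thr : seq nat) (a : nat) (N1 : seq bool)
    (neigh2 : seq nat) (k : nat) (S : table) : timed table :=
  let* lo := cost 2 (nth 0 thr k.-1) in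
  let* hi := cost 1 (nth 0 thr k) in
  let* N2 := map_timed (fun v => cost 1 (v <= lo)) neigh2 in
  let* N := map_timed (fun x => cost 1 (x.1 && x.2)) (zip N1 N2) in
  let* l := binary_value_timed N in
  let* change := cost 1 (pre`_l)%R in
  add_range a change lo hi S.

Lemma result_process_cube_loop (d m2 : nat) (pre : seq int)
    (a1 a2 : array pixel nat) (p : pixel) (S : table) :
  (process_cube d m2 pre a1 a2 p S).1 =
  let c := shift p (centre d) in
  let thr := (thresholds m2 (a2 c) (neigh_values d a2 p)).1 in
  let N1 := comparison1 d (a1 c) (neigh_values d a1 p) in
  (loop (index_iota 1 (size thr))
     (process_range pre thr (a1 c) N1 (neigh_values d a2 p)) S).1.
Proof.
rewrite /process_cube !result_bind.
have e a : (neigh d a p).1 = neigh_values d a p by rewrite /neigh result_map_timed.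
have e1 a r : (compare1 d a r).1 = comparison1 d a r.
  by rewrite /compare1 result_map_timed.
rewrite !e e1; by [].
Qed.

Lemma result_process_range (pre : seq int) (thr : seq nat) (a : nat)
    (N1 : seq bool) (neigh2 : seq nat) (k : nat) (S : table) (s t : nat) :
  let lo := nth 0 thr k.-1 in
  ((process_range pre thr a N1 neigh2 k S).1 (s, t) = S (s, t) +
   if (s == a) && (lo <= t < nth 0 thr k)%N then
     pre`_(binary_value (neighbourhood N1 neigh2 lo)) else 0)%R.
Proof.
rewrite /process_range !result_bind result_add_range.
by rewrite !result_map_timed /binary_value_timed result_loop.
Qed.

(** The code compares neighbours with the threshold [lo] opening the range of [t]. Comparing with
    [t] itself gives the same array, as no neighbour value lies in [(lo, t]]. *)
Lemma result_process_cube (d m2 : nat) (pre : seq int)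
    (a1 a2 : array pixel nat) (p : pixel) (S : table) (s t : nat) :
  let c := shift p (centre d) in
  a2 c <= m2 -> (forall q, a2 q <= m2.+1) ->
  ((process_cube d m2 pre a1 a2 p S).1 (s, t) = S (s, t) +
   if (s == a1 c) && (a2 c <= t <= m2)%N then
     pre`_(binary_value (neighbourhood
       (comparison1 d (a1 c) (neigh_values d a1 p)) (neigh_values d a2 p) t))
   else 0)%R.
Proof.
move=> c cm am; rewrite result_process_cube_loop -/c; cbv zeta.
have [|l [-> bl lastl inl _]] := @thresholds_spec m2 (a2 c) (neigh_values d a2 p) cm.
  by apply/allP => _ /mapP [o _ ->].
set N1 := comparison1 _ _ _; set neigh2 := neigh_values _ _ _ in inl *.
set b := a2 c in bl lastl inl *; set thr := b :: l.
rewrite result_loop (foldl_add _ (fun S' k _ => result_process_range _ _ _ _ _ _ _ _ _)).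
congr (_ + _)%R; case: (s == a1 c) => /=; last by rewrite big1_eq.
have := sum_consecutive_ranges t (pre`_(binary_value (neighbourhood N1 neigh2 t)))%R bl.
rewrite lastl ltnS => <-; apply: eq_big_nat => k /andP [k0 kl].
case: ifP => // /andP [lot thi]; congr (nth _ _ (binary_value _)).
rewrite /neighbourhood; congr (map _ (zip _ _)); apply/eq_in_map => v /inl vl.
apply/idP/idP => [|vt]; first by move/leq_trans; apply.
have mono i j : i <= j -> j < size thr -> nth 0 thr i <= nth 0 thr j.
  rewrite leq_eqVlt => /orP [/eqP -> //|ij] jl; apply: ltnW.
  by apply: (sorted_ltn_nth ltn_trans) => //; rewrite inE // (ltn_trans ij).
(* Values at most [b] are below every threshold; the larger ones occur in [thr]. *)
have [vb|/vl vin] := leqP v b.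
  by apply: leq_trans vb _; apply: (mono 0) => //; rewrite (leq_ltn_trans (leq_pred k)).
have vthr : v \in thr by rewrite inE vin orbT.
(* If [v] had index at least [k] in [thr], it would be at least the next threshold, which exceeds
   [t]. *)
rewrite -(nth_index 0 vthr); apply: (mono).
  rewrite -ltnS prednK // ltnNge; apply/negP => /mono; rewrite index_mem nth_index //.
  by move=> /(_ vthr) hv; move: (leq_trans hv vt); rewrite leqNgt thi.
by rewrite (leq_ltn_trans (leq_pred k)).
Qed.

(** * Running time for one cube *)

Definition cube_time (d : nat) : nat :=
  let K := size (neighbours d) in
  3 * d + 2 * ((2 * d).+2 * K + 1) + ((4 * K + 3) * K.+1 + 2) + (4 * K + 1) +
  (9 * K + 9) * K.+1 + 1.

(** Three passes over the neighbours cost 3 per entry each, and each update of a table entry costs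
    6, loop tests included. *)
Lemma time_process_range (pre : seq int) (thr : seq nat) (a : nat)
    (N1 : seq bool) (neigh2 : seq nat) (k : nat) (S : table) :
  (process_range pre thr a N1 neigh2 k S).2 <=
  9 * size neigh2 + 8 + 6 * (nth 0 thr k - nth 0 thr k.-1).
Proof.
rewrite /process_range !time_bind !(@time_map_timed _ _ _ _ 1) //.
set N2 := (map_timed _ neigh2).1; set N := (map_timed _ (zip _ _)).1.
have sN2 : size (zip N1 N2) <= size neigh2.
  by rewrite size_zip /N2 result_map_timed size_map geq_minr.
have sN : size N <= size neigh2 by rewrite /N result_map_timed size_map.
have : (binary_value_timed N).2 <= 3 * size N + 1 by apply: time_loop_const.
set v := (cost 1 _).1; have := time_add_range a v (nth 0 thr k.-1) (nth 0 thr k) S.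
rewrite /=; lia.
Qed.

Lemma time_process_cube_sum (d m2 : nat) (pre : seq int)
    (a1 a2 : array pixel nat) (p : pixel) (S : table) :
  let c := shift p (centre d) in
  let neigh1 := neigh d a1 p in
  let neigh2 := neigh d a2 p in
  let thr := thresholds m2 (a2 c) neigh2.1 in
  let N1 := compare1 d (a1 c) neigh1.1 in
  (process_cube d m2 pre a1 a2 p S).2 =
  3 * d + neigh1.2 + neigh2.2 + thr.2 + N1.2 +
  (loop (index_iota 1 (size thr.1))
     (process_range pre thr.1 (a1 c) N1.1 neigh2.1) S).2.
Proof. by rewrite /process_cube !time_bind !addnA !mulSn mul0n addn0 addnA. Qed.

Lemma time_process_cube (d m2 : nat) (pre : seq int)
    (a1 a2 : array pixel nat) (p : pixel) (S : table) :
  a2 (shift p (centre d)) <= m2 -> (forall q, a2 q <= m2.+1) ->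
  (process_cube d m2 pre a1 a2 p S).2 <= cube_time d + 6 * m2.+1.
Proof.
rewrite time_process_cube_sum; set c := shift p (centre d) => cm am; cbv zeta.
have ev a : (neigh d a p).1 = neigh_values d a p by rewrite /neigh result_map_timed.
have et a : (neigh d a p).2 = (2 * d).+2 * size (neighbours d) + 1.
  by rewrite /neigh (@time_map_timed _ _ _ _ (2 * d)) // => o; rewrite mul2n -addnn.
rewrite !et !ev.
have sz a : size (neigh_values d a p) = size (neighbours d) by rewrite size_map.
have -> : (compare1 d (a1 c) (neigh_values d a1 p)).2 = 4 * size (neighbours d) + 1.
  by rewrite /compare1 (@time_map_timed _ _ _ _ 2) // size_zip size_iota minnn sz.
have := time_thresholds m2 (a2 c) (neigh_values d a2 p); rewrite sz.
have [|l [-> bl lastl _ sl]] := @thresholds_spec m2 (a2 c) (neigh_values d a2 p) cm.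
  by apply/allP => _ /mapP [o _ ->].
rewrite sz in sl; move: (thresholds _ _ _).2 (compare1 _ _ _).1 => T N1.
set thr := _ :: l.
have := @time_loop _ _ (index_iota 1 (size thr)) (process_range pre thr (a1 c) N1
  (neigh_values d a2 p)) _ S (fun k S' _ => time_process_range _ _ _ _ _ _ _).
move: (loop _ _ _).2 => L; rewrite sz /cube_time.
have : \sum_(k <- index_iota 1 (size thr))
   (9 * size (neighbours d) + 8 + 6 * (nth 0 thr k - nth 0 thr k.-1)).+1 <=
   (9 * size (neighbours d) + 9) * (size (neighbours d)).+1 + 6 * m2.+1.
  (* The fixed part is paid once per range, at most [(size (neighbours d)).+1] times; the gaps add
     up to at most [m2.+1]. *)
  under eq_bigr do rewrite -addSn.
  rewrite big_split -big_distrr sum_consecutive_gaps // lastl sum_nat_const_nat /=.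
  rewrite subSS subn0; nia.
move: (bigop _ _ _) => B; lia.
Qed.

(** * Correctness and running time *)

Lemma comparison1E (d a : nat) (f : pixel -> nat) :
  [seq i < (3 ^ d - 1)./2 | i <- iota 0 (size (neighbours d))] =
  [seq lexlt o (centre d) | o <- neighbours d] ->
  comparison1 d a [seq f o | o <- neighbours d] =
  [seq if lexlt o (centre d) then f o <= a else f o < a | o <- neighbours d].
Proof.
rewrite /comparison1 size_map; move: (neighbours d) (iota _ _) => ns r.
by elim: r ns => [|i r IH] [|o ns] //= [-> /IH ->].
Qed.

(** A finite check: the procedure splits the array by index, the proof by comparison with the
    centre. *)
Lemma neighbours_row_order (d : nat) : d = 2 \/ d = 3 ->
  [seq i < (3 ^ d - 1)./2 | i <- iota 0 (size (neighbours d))] =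
  [seq lexlt o (centre d) | o <- neighbours d].
Proof. by case=> ->; vm_compute. Qed.

Lemma size_neighbours (d : nat) : d = 2 \/ d = 3 ->
  size (neighbours d) = 3 ^ d - 1.
Proof. by case=> ->; vm_compute. Qed.

Lemma mem_neighbours_grid (d : nat) (o : pixel) :
  o \in neighbours d -> o \in grid (nseq d 3).
Proof. by rewrite mem_filter => /andP []. Qed.

Lemma centre_grid (d : nat) : centre d \in grid (nseq d 3).
Proof. by rewrite mem_grid; elim: d. Qed.

Lemma pad_shift (sh : seq nat) (m : nat) (M : gray_image) (p o : pixel) :
  p \in grid sh -> o \in grid (nseq (size sh) 3) ->
  (pad (size sh) sh m M).1 (shift p o) = padded sh m M (shift p o).
Proof. by move=> psh og; rewrite result_pad shift_grid. Qed.

Lemma pad_centre (sh : seq nat) (m : nat) (M : gray_image) (p : pixel) :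
  p \in grid sh -> (pad (size sh) sh m M).1 (shift p (centre (size sh))) = M p.
Proof.
by move=> psh; rewrite pad_shift ?centre_grid // shiftC padded_shift.
Qed.

Lemma pad_le (sh : seq nat) (m : nat) (M : gray_image) (q : pixel) :
  intensities_le sh M m -> (pad (size sh) sh m M).1 q <= m.+1.
Proof. by move=> Mm; rewrite result_pad; case: ifP => // _; exact: padded_le. Qed.

(** The array $N^C$ is [present] evaluated on the neighbours, so masking by it is filtering by
    [present], and [change_local] moves the tabulated change to the image. *)
Lemma preCompChanges_change (sh : seq nat) (m1 m2 : nat) (M1 M2 : gray_image)
    (pre : seq int) (t : nat) (p : pixel) :
  let d := size sh in
  d = 2 \/ d = 3 -> intensities_le sh M1 m1 -> is_preCompChanges d pre ->
  p \in grid sh -> t <= m2 ->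
  (pre`_(binary_value (neighbourhood
      (comparison1 d (M1 p) (neigh_values d (pad d sh m1 M1).1 p))
      (neigh_values d (pad d sh m2 M2).1 p) t)) =
   change p (filter (earlier sh M1 M2 t p) (grid sh)))%R.
Proof.
move=> d hd hM1 hpre psh tm.
have -> : neighbourhood (comparison1 d (M1 p) (neigh_values d (pad d sh m1 M1).1 p))
    (neigh_values d (pad d sh m2 M2).1 p) t =
    map (present sh m1 m2 M1 M2 t p) (neighbours d).
  rewrite /neighbourhood /neigh_values comparison1E ?neighbours_row_order //.
  rewrite -map_comp zip_map -map_comp; apply/eq_in_map => o /mem_neighbours_grid og.
  by rewrite /= /present !pad_shift.
have [_ ->] := hpre; last by rewrite size_map size_neighbours.
rewrite -filter_mask euler_cons => [|q]; first exact: change_local.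
rewrite inE mem_filter => /orP [/eqP ->|/andP [_ /size_neighbour //]].
exact: size_centre.
Qed.

Lemma result_main_loop (sh : seq nat) (m1 m2 : nat) (M1 M2 : gray_image)
    (pre : seq int) (s t : nat) :
  let d := size sh in
  d = 2 \/ d = 3 -> intensities_le sh M1 m1 -> intensities_le sh M2 m2 ->
  is_preCompChanges d pre -> s <= m1 -> t <= m2 ->
  ((main_loop d sh m1 m2 M1 M2 pre).1 (s, t) =
   \sum_(p <- grid sh | (M1 p == s) && (M2 p <= t)%N)
     change p (filter (earlier sh M1 M2 t p) (grid sh)))%R.
Proof.
move=> d hd hM1 hM2 hpre sm tm; rewrite /main_loop 3!result_bind result_loop.
rewrite (@foldl_add _ _ _ (fun p => if (M1 p == s) && (M2 p <= t)
  then change p (filter (earlier sh M1 M2 t p) (grid sh)) else 0%R)).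
  by rewrite result_zero_table add0r -big_mkcond.
move=> S p psh; rewrite result_bind result_process_cube.
- by rewrite !pad_centre // eq_sym tm andbT; case: ifP => // _; rewrite preCompChanges_change.
- by rewrite pad_centre // hM2.
- by move=> q; exact: pad_le.
Qed.

(** With [ps] the pixels of the previous row and [A] the new ones, the pixels earlier than a new [p]
    are [ps] and those of [A] preceding [p], so [euler_cat_sorted] applies. *)
Lemma main_loop_difference (sh : seq nat) (m1 m2 : nat) (M1 M2 : gray_image)
    (pre : seq int) (s t : nat) :
  let d := size sh in
  d = 2 \/ d = 3 -> intensities_le sh M1 m1 -> intensities_le sh M2 m2 ->
  is_preCompChanges d pre -> s <= m1 -> t <= m2 ->
  ((main_loop d sh m1 m2 M1 M2 pre).1 (s, t) =
   euler d (cube_sublevel sh M1 M2 s t) -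
   euler d (if s is s'.+1 then cube_sublevel sh M1 M2 s' t else fset0))%R.
Proof.
move=> d hd hM1 hM2 hpre sm tm; rewrite result_main_loop //.
pose ps := [seq p <- grid sh | (M1 p < s) && (M2 p <= t)].
pose A p := (M1 p == s) && (M2 p <= t).
(* For [s = 0] no intensity is below [s], which matches the convention that the preceding complex is
   empty. *)
have -> : (if s is s'.+1 then cube_sublevel sh M1 M2 s' t else fset0) = complex_of ps.
  rewrite /ps; case: (s) => [|s'] //.
  by rewrite filter_pred0 complex_nil.
have -> : cube_sublevel sh M1 M2 s t = complex_of (ps ++ filter A (grid sh)).
  apply: eq_complex => q; rewrite mem_cat !mem_filter -andb_orl; congr (_ && _).
  by rewrite /A -andb_orl orbC -leq_eqVlt.
rewrite euler_cat_sorted ?grid_sorted //; last first.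
  by move=> q; rewrite mem_cat mem_filter => /orP [|/andP [_]] /size_mem_grid.
apply: eq_bigr => p /andP [/eqP ps_ pt]; apply: eq_change => c _.
congr (c \in _); apply: eq_complex => q.
rewrite mem_cat !mem_filter -andb_orl; congr (_ && _).
rewrite /earlier /A ps_.
by case: (M1 q < s); case: (M1 q == s); case: (M2 q <= t); case: (lexlt q p).
Qed.

Lemma result_cumulative_sum (m1 m2 : nat) (S : table) (s t : nat) :
  s <= m1 -> t <= m2 ->
  ((cumulative_sum m1 m2 S).1 (s, t) = \sum_(s' < s.+1) S (s' : nat, t))%R.
Proof.
move=> sm tm.
(* One pass writes only in row [s0.+1] and each column once, so the in-place reads still see the
   values of [S']. *)
have row s0 r S' x y : uniq r ->
  ((loop r (fun t S =>
      let* x := read 3 S (s0, t) in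
      let* y := read 2 S (s0.+1, t) in
      let* z := cost 1 (x + y) in
      write 2 S (s0.+1, t) z) S').1 (x, y) =
   if (x == s0.+1) && (y \in r) then S' (s0, y) + S' (x, y) else S' (x, y))%R.
  elim: r S' => [|t' r IH] S' /=; first by rewrite andbF.
  move=> /andP [t'r ur]; rewrite IH // inE /write /= !xpair_eqE.
  rewrite (ltn_eqF (ltnSn s0)) /=.
  case: eqVneq => [->|_] //=; case: eqVneq => [->|_] //=.
  by rewrite (negbTE t'r).
rewrite /cumulative_sum result_loop.
(* Invariant: after [k] passes the rows up to [k] hold their partial sums and the others are
   untouched. *)
have h k : (foldl (fun S s => (loop (iota 0 m2.+1) (fun t S =>
      let* x := read 3 S (s.-1, t) in
      let* y := read 2 S (s, t) in
      let* z := cost 1 (x + y) in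
      write 2 S (s, t) z) S).1) S (iota 1 k) (s, t) =
   if (s <= k)%N then \sum_(s' < s.+1) S (s' : nat, t) else S (s, t))%R.
  elim: k s {sm} => [|k IH] s.
    case: s => [|s]; by rewrite ?big_ord1.
  have -> : iota 1 k.+1 = rcons (iota 1 k) k.+1 by rewrite -[k.+1]addn1 iotaD cats1 add1n addn1.
  rewrite foldl_rcons row ?iota_uniq // !IH mem_iota add0n ltnS tm andbT leqnn.
  case: eqVneq => [->|ns]; first by rewrite ltnn leqnn [RHS]big_ord_recr.
  by rewrite [in RHS]leq_eqVlt (negbTE ns).
by rewrite h sm.
Qed.

(** Stated for any [F] equal to [cube_sublevel], so that it also serves [sublevel] when the minima
    are jointly attained. *)
Lemma cube_sublevel_correct (sh : seq nat) (m1 m2 : nat) (M1 M2 : gray_image)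
    (pre : seq int) (F : nat -> nat -> {fset cube}) :
  let d := size sh in
  d = 2 \/ d = 3 -> intensities_le sh M1 m1 -> intensities_le sh M2 m2 ->
  is_preCompChanges d pre ->
  (forall s t, F s t = cube_sublevel sh M1 M2 s t) ->
  correct_for d m1 m2 F (result (main_loop d sh m1 m2 M1 M2 pre))
    (result (procedure d sh m1 m2 M1 M2 pre)).
Proof.
move=> d hd hM1 hM2 hpre FE.
have main s t : s <= m1 -> t <= m2 ->
    (result (main_loop d sh m1 m2 M1 M2 pre) (s, t) =
       euler d (F s t) - euler d (if s is s'.+1 then F s' t else fset0))%R.
  by move=> sm tm; rewrite /result main_loop_difference // FE; case: (s) => // s'; rewrite FE.
have final s t : s <= m1 -> t <= m2 ->
    result (procedure d sh m1 m2 M1 M2 pre) (s, t) = euler d (F s t).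
  move=> sm tm; rewrite /result result_bind result_cumulative_sum //.
  move: main; rewrite /result; move: (main_loop _ _ _ _ _ _ _).1 => S main.
  have e0 : euler d fset0 = 0%R.
    by rewrite euler_sum ?big_seq_fset0 // => c; rewrite in_fset0.
  (* The sum of the row differences telescopes down to the empty complex. *)
  elim: s sm => [|s IH] sm; first by rewrite big_ord1 main // e0 subr0.
  by rewrite big_ord_recr IH 1?ltnW //= main // addrC subrK.
split=> //; apply/matrixP => s t; by rewrite !mxE final // -ltnS ltn_ord.
Qed.

Lemma list_min_le (s : seq nat) (x : nat) : x \in s -> list_min s <= x.
Proof.
(* The initial value of the fold is generalised, since the head changes along the induction. *)
rewrite /list_min; elim: s (head 0 s) => [//|y s IH] z /=.
rewrite inE geq_min => /orP [/eqP ->|/IH ->]; by rewrite ?leqnn ?orbT.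
Qed.

Lemma filtering_le (sh : seq nat) (M : gray_image) (p : pixel) (c : cube) :
  p \in grid sh -> c \in faces (top_cube p) -> filtering sh M c <= M p.
Proof.
move=> psh cp; apply: list_min_le; apply: map_f.
by rewrite mem_filter cp.
Qed.

(** A pixel attaining both minima on [c] yields one cube that witnesses both bounds; the converse
    inclusion follows from [filtering_le]. *)
Lemma sublevel_jointly_attained (sh : seq nat) (M1 M2 : gray_image) (s t : nat) :
  jointly_attained sh M1 M2 -> sublevel sh M1 M2 s t = cube_sublevel sh M1 M2 s t.
Proof.
move=> att; apply/fsetP => c; rewrite /cube_sublevel mem_complex [LHS]in_fset inE /=. 
apply/andP/hasP => [[cg /andP [cs ct]]|[p]].
  have [p [psh cp e1 e2]] := att c cg.
  by exists p => //; rewrite mem_filter e1 e2 cs ct.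
rewrite mem_filter => /andP [/andP [ps pt] psh] cp; split.
  by rewrite mem_complex; apply/hasP; exists p.
by rewrite !(leq_trans (filtering_le _ psh cp)).
Qed.

(** * Total running time *)

Lemma time_cumulative_sum (m1 m2 : nat) (S : table) :
  (cumulative_sum m1 m2 S).2 <= (9 * m2.+1 + 2) * m1 + 1.
Proof.
have := @time_loop_const _ _ (iota 1 m1) (fun s S =>
    loop (iota 0 m2.+1) (fun t S =>
      let* x := read 3 S (s.-1, t) in
      let* y := read 2 S (s, t) in
      let* z := cost 1 (x + y)%R in
      write 2 S (s, t) z) S) (9 * m2.+1 + 1) S.
rewrite size_iota addn2 addn1; apply => s S' _.
have := @time_loop_const _ _ (iota 0 m2.+1) (fun t S =>
      let* x := read 3 S (s.-1, t) in
      let* y := read 2 S (s, t) in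
      let* z := cost 1 (x + y)%R in
      write 2 S (s, t) z) 8 S'.
by rewrite size_iota addn1; apply.
Qed.

Lemma time_main_loop (sh : seq nat) (m1 m2 : nat) (M1 M2 : gray_image)
    (pre : seq int) :
  let d := size sh in
  let padding := (7 * d).+2 * size (grid [seq k.+2 | k <- sh]) + 1 in
  intensities_le sh M2 m2 ->
  (main_loop d sh m1 m2 M1 M2 pre).2 <=
  padding + (padding + ((3 * m2.+1 + 2) * m1.+1 + 1 +
    ((d + (cube_time d + 6 * m2.+1)).+1 * size (grid sh) + 1))).
Proof.
move=> d padding hM2; rewrite /main_loop 3!time_bind.
apply: leq_add; first exact: time_pad.
apply: leq_add; first exact: time_pad.
apply: leq_add; first exact: time_zero_table.
apply: time_loop_const => p S psh.
rewrite time_bind leq_add2l; apply: time_process_cube.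
  by rewrite pad_centre // hM2.
by move=> q; exact: pad_le.
Qed.

(** A nonempty grid has all sides positive, and [k + 2 <= 3 * k] for [k >= 1]. *)
Lemma size_padded_grid (sh : seq nat) : 0 < size (grid sh) ->
  size (grid [seq k.+2 | k <- sh]) <= 3 ^ size sh * size (grid sh).
Proof.
rewrite !size_grid; elim: sh => [|k sh IH]; first by rewrite !big_nil.
rewrite /= !big_cons muln_gt0 => /andP [k0 /IH {}IH].
rewrite expnS mulnACA; apply: leq_mul => //; lia.
Qed.

Lemma time_procedure (sh : seq nat) (m1 m2 : nat) (M1 M2 : gray_image)
    (pre : seq int) :
  let d := size sh in
  intensities_le sh M2 m2 -> 0 < size (grid sh) -> 0 < m2 ->
  (procedure d sh m1 m2 M1 M2 pre).2 <=
  (2 * ((7 * d).+2 * 3 ^ d) + (d + cube_time d) + 50) *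
  (size (grid sh) * m2 + m1 * m2).
Proof.
move=> d hM2 n0 m0; rewrite /procedure time_bind.
have := time_cumulative_sum m1 m2 (main_loop d sh m1 m2 M1 M2 pre).1.
have := time_main_loop m1 M1 pre hM2; rewrite -/d; cbv zeta.
have := leq_mul (leqnn (7 * d).+2) (size_padded_grid n0).
move: (cumulative_sum _ _ _).2 (main_loop _ _ _ _ _ _ _).2 => T1 T2.
rewrite mulnA -/d; move: (_ * 3 ^ _) (_ * size (grid (map _ _))) => C1 X.
rewrite [d + (_ + _)]addnA; move: (d + cube_time d) (size (grid sh)) n0 => C2 n n0 hX hT2 hT1.
(* Nonlinear facts for [lia]: as [n] and [m2] are positive, all lower-order terms are absorbed. *)
have nm : n <= n * m2 by rewrite leq_pmulr.
have : C1 * n <= C1 * (n * m2 + m1 * m2) by rewrite leq_mul2l; lia.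
have : C2 * n <= C2 * (n * m2 + m1 * m2) by rewrite leq_mul2l; lia.
have : m1 <= m1 * m2 by rewrite leq_pmulr.
have : m2 <= n * m2 by rewrite leq_pmull.
lia.
Qed.

Theorem mainTheorem2 (d : nat) (hd : d = 2 \/ d = 3) :
  exists c : nat,
  forall (sh : d.-tuple nat) (m1 m2 : nat) (M1 M2 : gray_image) (pre : seq int),
    intensities_le sh M1 m1 ->
    intensities_le sh M2 m2 ->
    is_preCompChanges d pre ->
    let n := size (grid sh) in
    let Smain := result (main_loop d sh m1 m2 M1 M2 pre) in
    let P := procedure d sh m1 m2 M1 M2 pre in
    [/\ correct_for d m1 m2 (cube_sublevel sh M1 M2) Smain (result P),
        jointly_attained sh M1 M2 ->
          correct_for d m1 m2 (sublevel sh M1 M2) Smain (result P) &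
        0 < n -> 0 < m2 -> running_time P <= c * (n * m2 + m1 * m2)].
Proof.
(* Two paddings with at most [3 ^ d] indices per pixel, the work per cube that is free of [m2], and
   50 for all remaining terms. *)
exists (2 * ((7 * d).+2 * 3 ^ d) + (d + cube_time d) + 50).
move=> sh m1 m2 M1 M2 pre; move: (tval sh) (size_tuple sh) => {}sh sd.
subst d => hM1 hM2 hpre.
split; first exact: cube_sublevel_correct.
  by move=> att; apply: cube_sublevel_correct => // s t; exact: sublevel_jointly_attained.
exact: time_procedure.
Qed.
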